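(* Let $n\in\mathbb{Z}$, let $A$ be a graded algebra with an $n$-graded double bracket $\{\!\!\{-,-\}\!\!\}$, let $v:M\otimes M\to\mathbb{K}$ be a cyclic bilinear form on a counital coalgebra $M$, and let $\{-,-\}_v$ be the induced $n$-graded biderivation in $A_M$. Then: (i) $v$ is symmetric; (ii) the action of $U=U(M^* )$ on $A_M$ preserves the bracket $\{-,-\}_v$; (iii) the fixed point algebra $A_M^U=\{x\in A_M\mid ux=x\text{ for all }u\in U\}$ is closed under the bracket $\{-,-\}_v$.
   Context: All modules, (co)algebras and tensor products are over a fixed commutative ring $\mathbb{K}$. Algebras are associative, not necessarily unital; coalgebras are coassociative and not graded. Graded means $\mathbb{Z}$-graded, $|a|$ is the degree of a homogeneous element $a$, and $|a|_n=|a|+n$. Iterated comultiplication in $M$ with values in $M^{\otimes m}$ is written $\alpha\mapsto\alpha^1\otimes\cdots\otimes\alpha^m$ (summation suppressed). Elements of $A\otimes A$ are written $x=x'\otimes x''$ (summation suppressed, homogeneous factors). Representation algebra: $A_M$ is the graded algebra generated by symbols $a_\alpha$ ($a\in A$, $\alpha\in M$), $|a_\alpha|=|a|$, subject to bilinearity of $a_\alpha$ in $(a,\alpha)$, $(ab)_\alpha=a_{\alpha^1}b_{\alpha^2}$, and $a_\alpha b_\beta=(-1)^{|a||b|}b_\beta a_\alpha$ for homogeneous $a,b$. Double brackets: let $P_{21,n}(a\otimes b)=(-1)^{|a|_n|b|_n}b\otimes a$ and $P_{21}=P_{21,0}$. Put $a(x\otimes y)b=ax\otimes yb$ and $a*(x\otimes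 y)*b=(-1)^{|a||xb|+|b||y|}xb\otimes ay$. An $n$-graded double bracket in $A$ is a linear endomorphism $\{\!\!\{-,-\}\!\!\}$ of $A^{\otimes2}$ such that $\{\!\!\{A^p,A^q\}\!\!\}\subset\bigoplus_{i+j=p+q+n}A^i\otimes A^j$; $\{\!\!\{-,-\}\!\!\}P_{21,n}=-P_{21}\{\!\!\{-,-\}\!\!\}$; and for homogeneous $a,b,c$, $\{\!\!\{a,bc\}\!\!\}=\{\!\!\{a,b\}\!\!\}c+(-1)^{|a|_n|b|}b\{\!\!\{a,c\}\!\!\}$ and $\{\!\!\{ab,c\}\!\!\}=a*\{\!\!\{b,c\}\!\!\}+(-1)^{|b||c|_n}\{\!\!\{a,c\}\!\!\}*b$. Cyclic forms: a bilinear form $v:M\otimes M\to\mathbb{K}$ is cyclic if $\widehat v(\alpha\otimes\beta)=v(\alpha\otimes\beta^2)\beta^1\otimes\beta^3$ defines an endomorphism of $M\otimes M$ commuting with the flip of the factors. Biderivation: an $n$-graded biderivation in a graded algebra $B$ is a linear map $\{-,-\}:B\otimes B\to B$ with $\{B^p,B^q\}\subset B^{p+q+n}$, $\{a,bc\}=\{a,b\}c+(-1)^{|a|_n|b|}b\{a,c\}$, $\{ab,c\}=a\{b,c\}+(-1)^{|b||c|_n}\{a,c\}b$, $\{a,b\}=-(-1)^{|a|_n|b|_n}\{b,a\}$ for homogeneous $a,b,c$. $\{-,-\}_v$ denotes the unique $n$-graded biderivation in $A_M$ such that $\{a_\alpha,b_\beta\}_v=v(\alpha\otimes\beta^2)\{\!\!\{a,b\}\!\!\}'_{\beta^1}\{\!\!\{a,b\}\!\!\}''_{\beta^3}$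 for all $a,b\in A$, $\alpha,\beta\in M$. Action of $U(M^* )$: $M^*=\mathrm{Hom}_{\mathbb{K}}(M,\mathbb{K})$ is an algebra with product $(\varphi\psi)(\alpha)=\varphi(\alpha^1)\psi(\alpha^2)$ and unit the counit of $M$; $U=U(M^* )$ is its group of invertible elements. Each $u\in U$ acts on $M$ by the coalgebra automorphism $\alpha\mapsto{}^u\alpha=u^{-1}(\alpha^1)\,u(\alpha^3)\,\alpha^2$, and on $A_M$ by the graded algebra automorphism with $u\,a_\alpha=a_{({}^u\alpha)}$ for all $a\in A$, $\alpha\in M$. The action preserves the bracket if $\{ux,uy\}_v=u\{x,y\}_v$ for all $u\in U$, $x,y\in A_M$. *)

(* Defs.v *)
From HB Require Import structures.
From mathcomp Require Import all_boot all_order all_algebra.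
From mathcomp Require Import boolp generic_quotient.

Set Implicit Arguments.
Unset Strict Implicit.
Unset Printing Implicit Defensive.

Import GRing.Theory.

Local Open Scope ring_scope.
Local Open Scope quotient_scope.

Reserved Notation "u ⊗ v" (at level 40, left associativity).
Reserved Notation "a ** b" (at level 40, left associativity).

Definition bilin (K : pzRingType) (U V W : lmodType K) (f : U -> V -> W) :=
  (forall v, linear (f^~ v)) /\ (forall u, linear (f u)).

Section BilinTheory.
Variables (K : pzRingType) (U V W : lmodType K) (f : U -> V -> W).
Hypothesis fB : bilin f.

Lemma bilinDl u u' v : f (u + u') v = f u v + f u' v.
Proof. by have := fB.1 v 1 u u'; rewrite !scale1r. Qed.

Lemma bilinDr u v v' : f u (v + v') = f u v + f u v'.
Proof. by have := fB.2 u 1 v v'; rewrite !scale1r. Qed.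

Lemma bilin0l v : f 0 v = 0.
Proof. by apply: (addrI (f 0 v)); rewrite -bilinDl !addr0. Qed.

Lemma bilin0r u : f u 0 = 0.
Proof. by apply: (addrI (f u 0)); rewrite -bilinDr !addr0. Qed.

Lemma bilinZl c u v : f (c *: u) v = c *: f u v.
Proof. by have := fB.1 v c u 0; rewrite !addr0 bilin0l addr0. Qed.

Lemma bilinZr c u v : f u (c *: v) = c *: f u v.
Proof. by have := fB.2 u c v 0; rewrite !addr0 bilin0r addr0. Qed.

Lemma bilin_suml I r (P : pred I) F v :
  f (\sum_(i <- r | P i) F i) v = \sum_(i <- r | P i) f (F i) v.
Proof. by apply: (big_morph (f^~ v)) => [x y|]; rewrite ?bilinDl ?bilin0l. Qed.

Lemma bilin_sumr I r (P : pred I) F u :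
  f u (\sum_(i <- r | P i) F i) = \sum_(i <- r | P i) f u (F i).
Proof. by apply: (big_morph (f u)) => [x y|]; rewrite ?bilinDr ?bilin0r. Qed.

End BilinTheory.

(* The tensor product U ⊗ V is the set of finite formal sums of pairs (u, v), *)
(* modulo the congruence generated by the usual relations                     *)
Section Tensor.
Variables (K : comPzRingType) (U V : lmodType K).

Inductive tensor_eq : seq (U * V) -> seq (U * V) -> Prop :=
| tensor_eq_refl s : tensor_eq s s
| tensor_eq_sym s t : tensor_eq s t -> tensor_eq t s
| tensor_eq_trans s t r : tensor_eq s t -> tensor_eq t r -> tensor_eq s r
| tensor_eq_cat s s' t t' :
    tensor_eq s s' -> tensor_eq t t' -> tensor_eq (s ++ t) (s' ++ t')
| tensor_eq_comm s t : tensor_eq (s ++ t) (t ++ s)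
| tensor_eq_addl u u' v : tensor_eq [:: (u + u', v)] [:: (u, v); (u', v)]
| tensor_eq_addr u v v' : tensor_eq [:: (u, v + v')] [:: (u, v); (u, v')]
| tensor_eq_scale c u v : tensor_eq [:: (c *: u, v)] [:: (u, c *: v)]
| tensor_eq_zero v : tensor_eq [:: (0, v)] [::].

Definition tensor_eqb (s t : seq (U * V)) : bool := `[< tensor_eq s t >].

Lemma tensor_eqb_refl : reflexive tensor_eqb.
Proof. by move=> s; apply/asboolP; exact: tensor_eq_refl. Qed.

Lemma tensor_eqb_sym : symmetric tensor_eqb.
Proof. by move=> s t; apply/asboolP/asboolP; exact: tensor_eq_sym. Qed.

Lemma tensor_eqb_trans : transitive tensor_eqb.
Proof.
by move=> t s r /asboolP st /asboolP tr; apply/asboolP; exact: tensor_eq_trans st tr.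
Qed.

Canonical tensor_equiv :=
  EquivRel tensor_eqb tensor_eqb_refl tensor_eqb_sym tensor_eqb_trans.

Definition tensor : Type := {eq_quot tensor_equiv}.
HB.instance Definition _ := Choice.on tensor.
HB.instance Definition _ : EqQuotient _ tensor_equiv tensor :=
  EqQuotient.on tensor.

Lemma tensor_piP s t : \pi_tensor s = \pi_tensor t <-> tensor_eq s t.
Proof.
split=> [/eqmodP /asboolP //|st]; by apply/eqmodP/asboolP.
Qed.

Lemma tensor_reprP s : tensor_eq (repr (\pi_tensor s)) s.
Proof. by apply/tensor_piP; rewrite reprK. Qed.

Definition tensor_add (x y : tensor) : tensor := \pi_tensor (repr x ++ repr y).
Definition tensor_scale (c : K) (x : tensor) : tensor :=
  \pi_tensor [seq (c *: p.1, p.2) | p <- repr x].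

Lemma tensor_add_pi s t : tensor_add (\pi_tensor s) (\pi_tensor t) = \pi_tensor (s ++ t).
Proof. by apply/tensor_piP; apply: tensor_eq_cat; exact: tensor_reprP. Qed.

Lemma tensor_scale_eq c s t : tensor_eq s t ->
  tensor_eq [seq (c *: p.1, p.2) | p <- s] [seq (c *: p.1, p.2) | p <- t].
Proof.
elim=> {s t} [s|s t _|s t r _ st _|s s' t t' _ IHs _ IHt|s t|u u' v|u v v'|d u v|v] /=.
- exact: tensor_eq_refl.
- exact: tensor_eq_sym.
- exact: tensor_eq_trans st.
- by rewrite !map_cat; exact: tensor_eq_cat.
- by rewrite !map_cat; exact: tensor_eq_comm.
- by rewrite scalerDr; exact: tensor_eq_addl.
- exact: tensor_eq_addr.
- by rewrite scalerA mulrC -scalerA; exact: tensor_eq_scale.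
- by rewrite scaler0; exact: tensor_eq_zero.
Qed.

Lemma tensor_scale_pi c s :
  tensor_scale c (\pi_tensor s) = \pi_tensor [seq (c *: p.1, p.2) | p <- s].
Proof. by apply/tensor_piP; apply: tensor_scale_eq; exact: tensor_reprP. Qed.

Lemma tensor_ind (P : tensor -> Prop) : (forall s, P (\pi_tensor s)) -> forall x, P x.
Proof. by move=> Pp x; rewrite -[x]reprK. Qed.

Lemma tensor_addA : associative tensor_add.
Proof.
elim/tensor_ind=> s; elim/tensor_ind=> t; elim/tensor_ind=> r.
by rewrite !tensor_add_pi catA.
Qed.

Lemma tensor_addC : commutative tensor_add.
Proof.
elim/tensor_ind=> s; elim/tensor_ind=> t; rewrite !tensor_add_pi.
by apply/tensor_piP; exact: tensor_eq_comm.
Qed.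

Lemma tensor_add0 : left_id (\pi_tensor [::] : tensor) tensor_add.
Proof. by elim/tensor_ind=> s; rewrite tensor_add_pi. Qed.

Lemma tensor_map0_eq s : tensor_eq [seq (0 *: p.1, p.2) | p <- s] [::].
Proof.
elim: s => [|[u v] s IHs] /=; first exact: tensor_eq_refl.
rewrite scale0r -[_ :: _]cat1s -[[::]]cats0; apply: tensor_eq_cat => //.
exact: tensor_eq_zero.
Qed.

Lemma tensor_scaleDl x c d :
  tensor_scale (c + d) x = tensor_add (tensor_scale c x) (tensor_scale d x).
Proof.
elim/tensor_ind: x => s; rewrite !tensor_scale_pi tensor_add_pi.
apply/tensor_piP; elim: s => [|[u v] s IHs] /=; first exact: tensor_eq_refl.
rewrite scalerDl -[_ :: [seq ((c + d) *: _, _) | _ <- _]]cat1s.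
apply: tensor_eq_trans (tensor_eq_cat (tensor_eq_addl _ _ _) IHs) _ => /=.
rewrite -[X in tensor_eq X]cat1s -[X in tensor_eq _ X]cat1s.
apply: tensor_eq_cat; first exact: tensor_eq_refl.
rewrite -[_ :: _ ++ _]cat1s -[X in tensor_eq _ (_ ++ X)]cat1s !catA.
by apply: tensor_eq_cat; [exact: tensor_eq_comm | exact: tensor_eq_refl].
Qed.

Lemma tensor_addN : left_inverse (\pi_tensor [::] : tensor) (tensor_scale (-1)) tensor_add.
Proof.
elim/tensor_ind=> s.
have e : \pi_tensor s = tensor_scale 1 (\pi_tensor s).
  rewrite tensor_scale_pi; congr (\pi _); rewrite -[LHS]map_id.
  by apply: eq_map => -[u v] /=; rewrite scale1r.
rewrite [X in tensor_add _ X]e -tensor_scaleDl addNr tensor_scale_pi.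
by apply/tensor_piP; exact: tensor_map0_eq.
Qed.

HB.instance Definition _ := GRing.isZmodule.Build tensor
  tensor_addA tensor_addC tensor_add0 tensor_addN.

Lemma tensor_scaleA c d x :
  tensor_scale c (tensor_scale d x) = tensor_scale (c * d) x.
Proof.
elim/tensor_ind: x => s; rewrite !tensor_scale_pi -map_comp; congr (\pi _).
by apply: eq_map => -[u v] /=; rewrite scalerA.
Qed.

Lemma tensor_scale1 : left_id 1 tensor_scale.
Proof.
elim/tensor_ind=> s; rewrite tensor_scale_pi; congr (\pi _).
by rewrite -[RHS]map_id; apply: eq_map => -[u v] /=; rewrite scale1r.
Qed.

Lemma tensor_scaleDr : right_distributive tensor_scale +%R.
Proof.
move=> c; elim/tensor_ind=> s; elim/tensor_ind=> t.
change (tensor_scale c (tensor_add (\pi_tensor s) (\pi_tensor t)) =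
  tensor_add (tensor_scale c (\pi_tensor s)) (tensor_scale c (\pi_tensor t))).
by rewrite tensor_add_pi !tensor_scale_pi tensor_add_pi map_cat.
Qed.

HB.instance Definition _ := GRing.Zmodule_isLmodule.Build K tensor
  tensor_scaleA tensor_scale1 tensor_scaleDr tensor_scaleDl.

Definition tensor_pure (u : U) (v : V) : tensor := \pi_tensor [:: (u, v)].

Lemma tensor_pure_bilin : bilin tensor_pure.
Proof.
have sP c s : c *: (\pi_tensor s) = \pi_tensor [seq (c *: p.1, p.2) | p <- s].
  exact: tensor_scale_pi.
have aP s t : \pi_tensor s + \pi_tensor t = \pi_tensor (s ++ t).
  exact: tensor_add_pi.
split=> [v c u u'|u c v v'].
  by rewrite /tensor_pure sP aP; apply/tensor_piP; exact: tensor_eq_addl.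
rewrite /tensor_pure sP aP; apply/tensor_piP => /=.
apply: tensor_eq_trans (tensor_eq_addr _ _ _) _.
rewrite -[X in tensor_eq X]cat1s -[X in tensor_eq _ X]cat1s.
apply: tensor_eq_cat; last exact: tensor_eq_refl.
by apply: tensor_eq_sym; exact: tensor_eq_scale.
Qed.

Lemma tensor_piE s : \pi_tensor s = \sum_(p <- s) tensor_pure p.1 p.2.
Proof.
elim: s => [|[u v] s IHs]; first by rewrite big_nil.
by rewrite big_cons -IHs [RHS]tensor_add_pi.
Qed.

(* Sweedler notation: [sweedler x] lists the pairs (x', x'') of a chosen      *)
(* expression of x as a sum of pure tensors.                                  *)
Definition sweedler (x : tensor) : seq (U * V) := repr x.

Lemma sweedlerE x : \sum_(p <- sweedler x) tensor_pure p.1 p.2 = x.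
Proof. by rewrite -tensor_piE reprK. Qed.

Lemma tensor_linear_ext (W : lmodType K) (f g : {linear tensor -> W}) :
  (forall u v, f (tensor_pure u v) = g (tensor_pure u v)) -> f =1 g.
Proof.
move=> fg x; rewrite -[x]sweedlerE !linear_sum.
by apply: eq_bigr => p _; exact: fg.
Qed.

(* The linear map U ⊗ V -> W induced by a bilinear f (see [tlift_pure] and    *)
(* [tlift_linear]); on any other f the value depends on the representative.   *)
Definition tlift (W : lmodType K) (f : U -> V -> W) (x : tensor) : W :=
  \sum_(p <- sweedler x) f p.1 p.2.

Section Lift.
Variables (W : lmodType K) (f : U -> V -> W).
Hypothesis fB : bilin f.

Lemma tlift_eq s t : tensor_eq s t ->
  \sum_(p <- s) f p.1 p.2 = \sum_(p <- t) f p.1 p.2.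
Proof.
elim=> {s t} //.
- by move=> s t r _ -> _ ->.
- by move=> s s' t t' _ es _ et; rewrite !big_cat /= es et.
- by move=> s t; rewrite !big_cat /= addrC.
- by move=> u u' v; rewrite !big_cons !big_nil !addr0 /= bilinDl.
- by move=> u v v'; rewrite !big_cons !big_nil !addr0 /= bilinDr.
- by move=> c u v; rewrite !big_cons !big_nil !addr0 /= bilinZl ?bilinZr.
- by move=> v; rewrite !big_cons !big_nil !addr0 /= bilin0l.
Qed.

Lemma tlift_sum s :
  tlift f (\sum_(p <- s) tensor_pure p.1 p.2) = \sum_(p <- s) f p.1 p.2.
Proof. by rewrite -tensor_piE; exact/tlift_eq/tensor_reprP. Qed.

Lemma tlift_pure u v : tlift f (tensor_pure u v) = f u v.
Proof. by have := tlift_sum [:: (u, v)]; rewrite !big_seq1. Qed.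

Lemma tlift_linear : linear (tlift f).
Proof.
move=> c x y; rewrite -[in LHS](sweedlerE x) -[in LHS](sweedlerE y).
rewrite scaler_sumr.
rewrite (eq_bigr (fun p => tensor_pure (c *: p.1) p.2)); last first.
  by move=> p _; rewrite (bilinZl tensor_pure_bilin).
rewrite -(big_map (fun p : U * V => (c *: p.1, p.2)) xpredT
  (fun p => tensor_pure p.1 p.2)) -big_cat tlift_sum big_cat big_map /=.
rewrite /tlift scaler_sumr; congr (_ + _).
by apply: eq_bigr => p _; rewrite bilinZl.
Qed.

Lemma tlift_sumI (I : Type) (s : seq I) (F : I -> U) (G : I -> V) :
  tlift f (\sum_(i <- s) tensor_pure (F i) (G i)) = \sum_(i <- s) f (F i) (G i).
Proof. by have := tlift_sum [seq (F i, G i) | i <- s]; rewrite !big_map. Qed.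

End Lift.
End Tensor.

Notation "u ⊗ v" := (tensor_pure u v) : ring_scope.


(* Associative algebras, not necessarily unital *)
HB.mixin Record Lmodule_isNUAlgebra (K : comPzRingType) A of GRing.Lmodule K A := {
  amul : A -> A -> A;
  amulA : associative amul;
  amul_bilin : bilin amul
}.

#[short(type="nuAlgType")]
HB.structure Definition NUAlgebra (K : comPzRingType) :=
  {A of GRing.Lmodule K A & Lmodule_isNUAlgebra K A}.

Notation "a ** b" := (amul a b) : ring_scope.

(* [homog p] is the submodule of elements of degree p; A is the internal      *)
(* direct sum of these.                                                       *)
HB.mixin Record NUAlgebra_isGraded (K : comPzRingType) A of NUAlgebra K A := {
  homog : int -> A -> Prop;
  homog0 : forall p, homog p 0;
  homogP : forall p c x y, homog p x -> homog p y -> homog p (c *: x + y);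
  homogM : forall p q x y, homog p x -> homog q y -> homog (p + q) (x ** y);
  homog_decomp : forall x, exists s : seq (int * A),
    (forall i, i \in s -> homog i.1 i.2) /\ x = \sum_(i <- s) i.2;
  homog_direct : forall (S : seq int) (f : int -> A),
    uniq S -> (forall p, p \in S -> homog p (f p)) ->
    \sum_(p <- S) f p = 0 -> forall p, p \in S -> f p = 0
}.

#[short(type="galgType")]
HB.structure Definition GradedAlgebra (K : comPzRingType) :=
  {A of NUAlgebra K A & NUAlgebra_isGraded K A}.

Definition ksign (K : pzRingType) (m : int) : K := (-1) ^+ `|m|%N.

Section GradedTheory.
Variables (K : comPzRingType) (A : galgType K).
Implicit Types (a b x y : A) (p q : int).

Lemma homogD p x y : homog p x -> homog p y -> homog p (x + y).
Proof. by move=> hx hy; rewrite -[x]scale1r; exact: homogP. Qed.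

Lemma homogZ p c x : homog p x -> homog p (c *: x).
Proof. by move=> hx; rewrite -[c *: x]addr0; apply: homogP => //; exact: homog0. Qed.

Lemma homog_sum p (I : eqType) (r : seq I) (P : pred I) (F : I -> A) :
  (forall i, i \in r -> P i -> homog p (F i)) -> homog p (\sum_(i <- r | P i) F i).
Proof.
elim: r => [|i r IHr] hF; first by rewrite big_nil; exact: homog0.
have hr : homog p (\sum_(j <- r | P j) F j).
  by apply: IHr => j jr; apply: hF; rewrite inE jr orbT.
rewrite big_cons; case: ifP => // Pi; apply: homogD => //.
by apply: hF => //; exact: mem_head.
Qed.

(* A chosen decomposition of x as a sum of homogeneous elements, each listed  *)
(* with its degree.                                                           *)
Definition hdecomp x : seq (int * A) := sval (cid (homog_decomp x)).

Lemma hdecomp_homog x i : i \in hdecomp x -> homog i.1 i.2.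
Proof. by move: i; rewrite /hdecomp; case: cid => s []. Qed.

Lemma hdecompE x : \sum_(i <- hdecomp x) i.2 = x.
Proof. by rewrite /hdecomp; case: cid => s []. Qed.

End GradedTheory.

Definition coef (V : nmodType) (p : int) (s : seq (int * V)) : V :=
  \sum_(i <- s | i.1 == p) i.2.
Arguments coef {V}.

Lemma coef_sum (V W : nmodType) (S : seq int) (s : seq (int * V))
    (F : int -> V -> W) : uniq S -> {subset [seq i.1 | i <- s] <= S} ->
  \sum_(p <- S) \sum_(i <- s | i.1 == p) F i.1 i.2 = \sum_(i <- s) F i.1 i.2.
Proof.
move=> uS sS; rewrite (exchange_big_dep xpredT) //= big_seq [RHS]big_seq.
apply: eq_bigr => i si.
have iS : i.1 \in S by apply: sS; exact: map_f.
rewrite (big_rem _ iS) /= eqxx big1_seq ?addr0 // => p /andP[/eqP <-].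
by rewrite mem_rem_uniqF.
Qed.

Section HomogComponent.
Variables (K : comPzRingType) (A : galgType K).
Implicit Types (a b x y : A) (p q : int).

Definition hcomp p x : A := coef p (hdecomp x).

Lemma hcompE p x (s : seq (int * A)) :
    (forall i, i \in s -> homog i.1 i.2) -> x = \sum_(i <- s) i.2 ->
  hcomp p x = coef p s.
Proof.
move=> hs xE; pose d := hdecomp x.
pose S := undup (p :: [seq i.1 | i <- d] ++ [seq i.1 | i <- s]).
have hc (t : seq (int * A)) q : (forall i, i \in t -> homog i.1 i.2) ->
    homog q (coef q t).
  by move=> ht; apply: homog_sum => i it /eqP <-; exact: ht.
apply/eqP; rewrite -subr_eq0; apply/eqP.
pose f q := hcomp q x - coef q s.
have pS : p \in S by rewrite mem_undup mem_head.
rewrite -/(f p); apply: (@homog_direct _ A S f) pS => [|q _|].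
- exact: undup_uniq.
- rewrite /f addrC -scaleN1r; apply: homogP; apply: hc => //.
  exact: hdecomp_homog.
have tS (t : seq (int * A)) : {subset [seq i.1 | i <- t] <= S} ->
    \sum_(q <- S) coef q t = \sum_(i <- t) i.2.
  by move=> tS; rewrite /coef (coef_sum (fun _ v => v)) ?undup_uniq.
rewrite sumrB /hcomp !tS ?hdecompE -?xE ?subrr // => q qt;
  by rewrite mem_undup inE mem_cat qt ?orbT.
Qed.

Lemma hcomp_homog p q x : homog q x -> hcomp p x = if q == p then x else 0.
Proof.
move=> hx; rewrite (@hcompE p x [:: (q, x)]) ?big_seq1 //.
  by rewrite /coef big_mkcond big_seq1.
by move=> i; rewrite inE => /eqP ->.
Qed.

Lemma hcomp_linear p : linear (hcomp p).
Proof.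
move=> c x y.
rewrite (@hcompE p _ ([seq (i.1, c *: i.2) | i <- hdecomp x] ++ hdecomp y)).
- by rewrite /coef big_cat big_map /= -scaler_sumr.
- move=> i; rewrite mem_cat => /orP[/mapP[j jx ->] /=|]; last exact: hdecomp_homog.
  by apply: homogZ; exact: hdecomp_homog jx.
- by rewrite big_cat big_map /= -scaler_sumr !hdecompE.
Qed.

End HomogComponent.

Section DoubleBracket.
Variables (K : comPzRingType) (A : galgType K).

(* The value of f |x'| |x''| x' x'' at x = x' ⊗ x'' with homogeneous factors  *)
(* (see [glift_pure]), for f p q bilinear.                                    *)
Definition glift (W : lmodType K) (f : int -> int -> A -> A -> W) :
    tensor A A -> W :=
  tlift (fun x' x'' =>
    \sum_(i <- hdecomp x') \sum_(j <- hdecomp x'') f i.1 j.1 i.2 j.2).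

Lemma glift_pure (W : lmodType K) (f : int -> int -> A -> A -> W) p q x y :
  (forall p q, bilin (f p q)) -> homog p x -> homog q y ->
  glift f (x ⊗ y) = f p q x y.
Proof.
move=> fB hx hy.
have gE a b (S : seq int) : uniq S ->
    {subset [seq i.1 | i <- hdecomp a] <= S} ->
    {subset [seq i.1 | i <- hdecomp b] <= S} ->
    \sum_(i <- hdecomp a) \sum_(j <- hdecomp b) f i.1 j.1 i.2 j.2 =
    \sum_(r <- S) \sum_(t <- S) f r t (hcomp r a) (hcomp t b).
  move=> uS aS bS; rewrite -(coef_sum (fun r v =>
    \sum_(j <- hdecomp b) f r j.1 v j.2) uS aS).
  apply: eq_bigr => r _.
  under eq_bigr => i /eqP -> do
    rewrite -(coef_sum (fun t w => f r t i.2 w) uS bS).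
  rewrite exchange_big; apply: eq_bigr => t _ /=.
  rewrite (bilin_suml (fB r t)); apply: eq_bigr => i _.
  rewrite (bilin_sumr (fB r t)).
  by apply: eq_bigr => j /eqP ->.
have gB : bilin (fun x' x'' : A =>
    \sum_(i <- hdecomp x') \sum_(j <- hdecomp x'') f i.1 j.1 i.2 j.2).
  split=> [w c u v|w c u v];
    pose S := undup ([seq i.1 | i <- hdecomp (c *: u + v)] ++
      [seq i.1 | i <- hdecomp u] ++ [seq i.1 | i <- hdecomp v] ++
      [seq i.1 | i <- hdecomp w]);
    rewrite !(gE _ _ S) ?undup_uniq //=;
    try (by move=> r rS; rewrite mem_undup !mem_cat rS ?orbT);
    rewrite scaler_sumr -big_split; apply: eq_bigr => r _ /=;
    rewrite scaler_sumr -big_split; apply: eq_bigr => t _ /=;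
    rewrite hcomp_linear.
    by rewrite (bilinDl (fB r t)) (bilinZl (fB r t)).
  by rewrite (bilinDr (fB r t)) (bilinZr (fB r t)).
rewrite /glift tlift_pure //.
pose S := undup (p :: q :: [seq i.1 | i <- hdecomp x] ++ [seq i.1 | i <- hdecomp y]).
have uS : uniq S by exact: undup_uniq.
rewrite (gE _ _ S) //; try by move=> r rS; rewrite mem_undup !inE mem_cat rS ?orbT.
have pS : p \in S by rewrite mem_undup mem_head.
have qS : q \in S by rewrite mem_undup !inE eqxx orbT.
rewrite (bigD1_seq p) //= [X in _ + X]big1 ?addr0; last first.
  move=> r /negPf rp; rewrite big1 // => t _.
  by rewrite (hcomp_homog _ hx) eq_sym rp (bilin0l (fB r t)).
rewrite (bigD1_seq q) //= [X in _ + X]big1 ?addr0; last first.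
  by move=> t /negPf tq; rewrite (hcomp_homog _ hy) eq_sym tq (bilin0r (fB p t)).
by rewrite (hcomp_homog _ hx) (hcomp_homog _ hy) !eqxx.
Qed.

Definition graded_flip (n : int) : tensor A A -> tensor A A :=
  glift (fun p q x y => ksign K ((p + n) * (q + n)) *: (y ⊗ x)).

(* a (x ⊗ y) and (x ⊗ y) b *)
Definition outer_l (a : A) : tensor A A -> tensor A A :=
  tlift (fun x y => (a ** x) ⊗ y).
Definition outer_r (z : tensor A A) (b : A) : tensor A A :=
  tlift (fun x y => x ⊗ (y ** b)) z.

(* One-sided cases of a * (x ⊗ y) * b, with the factor b resp. a left out:    *)
(* a * (x ⊗ y) for a of degree p, and (x ⊗ y) * b for b of degree q.          *)
Definition inner_l (p : int) (a : A) : tensor A A -> tensor A A :=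
  glift (fun r s x y => ksign K (p * r) *: (x ⊗ (a ** y))).
Definition inner_r (q : int) (z : tensor A A) (b : A) : tensor A A :=
  glift (fun r s x y => ksign K (q * s) *: ((x ** b) ⊗ y)) z.

(* Membership in the sum of the A^i ⊗ A^j over i + j = m *)
Definition tensor_homog (m : int) (z : tensor A A) : Prop :=
  exists s : seq ((int * A) * (int * A)),
    (forall i, i \in s -> [/\ homog i.1.1 i.1.2, homog i.2.1 i.2.2
                            & i.1.1 + i.2.1 = m]) /\
    z = \sum_(i <- s) i.1.2 ⊗ i.2.2.

Record double_bracket (n : int) (D : {linear tensor A A -> tensor A A}) : Prop := {
  dbr_homog : forall p q a b, homog p a -> homog q b ->
    tensor_homog (p + q + n) (D (a ⊗ b));
  dbr_flip : forall x, D (graded_flip n x) = - graded_flip 0 (D x);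
  dbr_der_r : forall p q r a b c, homog p a -> homog q b -> homog r c ->
    D (a ⊗ (b ** c)) =
      outer_r (D (a ⊗ b)) c + ksign K ((p + n) * q) *: outer_l b (D (a ⊗ c));
  dbr_der_l : forall p q r a b c, homog p a -> homog q b -> homog r c ->
    D ((a ** b) ⊗ c) =
      inner_l p a (D (b ⊗ c)) + ksign K (q * (r + n)) *: inner_r q (D (a ⊗ c)) b
}.

Record biderivation (n : int) (br : {linear tensor A A -> A}) : Prop := {
  bider_homog : forall p q a b, homog p a -> homog q b ->
    homog (p + q + n) (br (a ⊗ b));
  bider_der_r : forall p q r a b c, homog p a -> homog q b -> homog r c ->
    br (a ⊗ (b ** c)) =
      br (a ⊗ b) ** c + ksign K ((p + n) * q) *: (b ** br (a ⊗ c));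
  bider_der_l : forall p q r a b c, homog p a -> homog q b -> homog r c ->
    br ((a ** b) ⊗ c) =
      a ** br (b ⊗ c) + ksign K (q * (r + n)) *: (br (a ⊗ c) ** b);
  bider_anti : forall p q a b, homog p a -> homog q b ->
    br (a ⊗ b) = - (ksign K ((p + n) * (q + n)) *: br (b ⊗ a))
}.

End DoubleBracket.


(* The value of f at an element of U ⊗ V ⊗ W, for f trilinear *)
Definition tlift3 (K : comPzRingType) (U V W X : lmodType K)
    (f : U -> V -> W -> X) : tensor (tensor U V) W -> X :=
  tlift (fun y w => tlift (fun u v => f u v w) y).

HB.mixin Record Lmodule_isCoalgebra (K : comPzRingType) M of GRing.Lmodule K M := {
  comul : {linear M -> tensor M M};
  comulA : forall α,
    tlift (fun β γ => comul β ⊗ γ) (comul α) =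
    tlift (fun β γ => tlift (fun γ1 γ2 => β ⊗ γ1 ⊗ γ2) (comul γ)) (comul α)
}.

#[short(type="coalgType")]
HB.structure Definition Coalgebra (K : comPzRingType) :=
  {M of GRing.Lmodule K M & Lmodule_isCoalgebra K M}.

HB.mixin Record Coalgebra_isCounital (K : comPzRingType) M of Coalgebra K M := {
  counit : {scalar M};
  counitl : forall α, tlift (fun β γ => counit β *: γ) (comul α) = α;
  counitr : forall α, tlift (fun β γ => counit γ *: β) (comul α) = α
}.

#[short(type="counitalCoalgType")]
HB.structure Definition CounitalCoalgebra (K : comPzRingType) :=
  {M of Coalgebra K M & Coalgebra_isCounital K M}.

Definition comul3 (K : comPzRingType) (M : coalgType K) (α : M) :
    tensor (tensor M M) M :=
  tlift (fun β γ => comul β ⊗ γ) (comul α).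

Section Cyclic.
Variables (K : comPzRingType) (M : coalgType K).

Definition flip : tensor M M -> tensor M M := tlift (fun α β => β ⊗ α).

Definition form_hat (v : {scalar tensor M M}) : tensor M M -> tensor M M :=
  tlift (fun α β =>
    tlift3 (fun β1 β2 β3 => v (α ⊗ β2) *: (β1 ⊗ β3)) (comul3 β)).

Definition cyclic_form (v : {scalar tensor M M}) : Prop :=
  forall x, form_hat v (flip x) = flip (form_hat v x).

End Cyclic.

Section DualUnits.
Variables (K : comPzRingType) (M : counitalCoalgType K).

Definition conv (φ ψ : {scalar M}) : M -> K :=
  tlift (W := K^o) (fun β γ => φ β * ψ γ) \o comul.

(* The group of invertible elements of M^*, each listed with its inverse *)
Record dual_unit := DualUnit {
  dual_val :> {scalar M};
  dual_inv : {scalar M};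
  dual_valK : conv dual_val dual_inv =1 counit;
  dual_invK : conv dual_inv dual_val =1 counit
}.

Definition unit_act (u : dual_unit) (α : M) : M :=
  tlift3 (fun α1 α2 α3 => (dual_inv u α1 * u α3) *: α2) (comul3 α).

End DualUnits.


(* The algebra A_M presented by the generators a_α and the stated relations:  *)
(* formal non-unital K-algebra expressions in the generators, modulo the      *)
(* least congruence containing the axioms of associative K-algebras and the   *)
(* defining relations.                                                        *)
Section RepAlgebraTerms.
Variables (K : comPzRingType) (A : galgType K) (M : coalgType K).

Inductive rterm :=
| RGen of A & M
| RZero
| RAdd of rterm & rterm
| RScale of K & rterm
| RMul of rterm & rterm.

HB.instance Definition _ := gen_eqMixin rterm.
HB.instance Definition _ := gen_choiceMixin rterm.

Inductive rrel : rterm -> rterm -> Prop :=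
| rrel_refl s : rrel s s
| rrel_sym s t : rrel s t -> rrel t s
| rrel_trans s t r : rrel s t -> rrel t r -> rrel s r
| rrel_add s s' t t' : rrel s s' -> rrel t t' -> rrel (RAdd s t) (RAdd s' t')
| rrel_scale c s s' : rrel s s' -> rrel (RScale c s) (RScale c s')
| rrel_mul s s' t t' : rrel s s' -> rrel t t' -> rrel (RMul s t) (RMul s' t')
| rrel_addA s t r : rrel (RAdd s (RAdd t r)) (RAdd (RAdd s t) r)
| rrel_addC s t : rrel (RAdd s t) (RAdd t s)
| rrel_add0 s : rrel (RAdd RZero s) s
| rrel_scaleA c d s : rrel (RScale c (RScale d s)) (RScale (c * d) s)
| rrel_scale1 s : rrel (RScale 1 s) s
| rrel_scale0 s : rrel (RScale 0 s) RZero
| rrel_scaleDr c s t : rrel (RScale c (RAdd s t)) (RAdd (RScale c s) (RScale c t))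
| rrel_scaleDl c d s : rrel (RScale (c + d) s) (RAdd (RScale c s) (RScale d s))
| rrel_mulA s t r : rrel (RMul s (RMul t r)) (RMul (RMul s t) r)
| rrel_mulDl s t r : rrel (RMul (RAdd s t) r) (RAdd (RMul s r) (RMul t r))
| rrel_mulDr s t r : rrel (RMul s (RAdd t r)) (RAdd (RMul s t) (RMul s r))
| rrel_mulZl c s t : rrel (RMul (RScale c s) t) (RScale c (RMul s t))
| rrel_mulZr c s t : rrel (RMul s (RScale c t)) (RScale c (RMul s t))
| rrel_genl c a b α :
    rrel (RGen (c *: a + b) α) (RAdd (RScale c (RGen a α)) (RGen b α))
| rrel_genr c a α β :
    rrel (RGen a (c *: α + β)) (RAdd (RScale c (RGen a α)) (RGen a β))
| rrel_genM a b α (s : seq (M * M)) : comul α = \sum_(p <- s) p.1 ⊗ p.2 ->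
    rrel (RGen (a ** b) α)
         (foldr RAdd RZero [seq RMul (RGen a p.1) (RGen b p.2) | p <- s])
| rrel_genC p q a b α β : homog p a -> homog q b ->
    rrel (RMul (RGen a α) (RGen b β))
         (RScale (ksign K (p * q)) (RMul (RGen b β) (RGen a α))).

Definition rrelb (s t : rterm) : bool := `[< rrel s t >].

Lemma rrelb_refl : reflexive rrelb.
Proof. by move=> s; apply/asboolP; exact: rrel_refl. Qed.

Lemma rrelb_sym : symmetric rrelb.
Proof. by move=> s t; apply/asboolP/asboolP; exact: rrel_sym. Qed.

Lemma rrelb_trans : transitive rrelb.
Proof.
by move=> t s r /asboolP st /asboolP tr; apply/asboolP; exact: rrel_trans st tr.
Qed.

Canonical rrel_equiv := EquivRel rrelb rrelb_refl rrelb_sym rrelb_trans.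

Definition repalg : Type := {eq_quot rrel_equiv}.
HB.instance Definition _ := Choice.on repalg.
HB.instance Definition _ : EqQuotient _ rrel_equiv repalg := EqQuotient.on repalg.

Lemma repalg_piP s t : \pi_repalg s = \pi_repalg t <-> rrel s t.
Proof. by split=> [/eqmodP /asboolP //|st]; apply/eqmodP/asboolP. Qed.

Lemma repalg_reprP s : rrel (repr (\pi_repalg s)) s.
Proof. by apply/repalg_piP; rewrite reprK. Qed.

Lemma repalg_ind (P : repalg -> Prop) :
  (forall s, P (\pi_repalg s)) -> forall x, P x.
Proof. by move=> Pp x; rewrite -[x]reprK. Qed.

Definition rep_add (x y : repalg) : repalg := \pi_repalg (RAdd (repr x) (repr y)).
Definition rep_scale c (x : repalg) : repalg := \pi_repalg (RScale c (repr x)).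
Definition rep_mul (x y : repalg) : repalg := \pi_repalg (RMul (repr x) (repr y)).

Lemma rep_addE s t : rep_add (\pi_repalg s) (\pi_repalg t) = \pi_repalg (RAdd s t).
Proof. by apply/repalg_piP/rrel_add; exact: repalg_reprP. Qed.

Lemma rep_scaleE c s : rep_scale c (\pi_repalg s) = \pi_repalg (RScale c s).
Proof. by apply/repalg_piP/rrel_scale; exact: repalg_reprP. Qed.

Lemma rep_mulE s t : rep_mul (\pi_repalg s) (\pi_repalg t) = \pi_repalg (RMul s t).
Proof. by apply/repalg_piP/rrel_mul; exact: repalg_reprP. Qed.

Lemma rep_addA : associative rep_add.
Proof.
elim/repalg_ind=> s; elim/repalg_ind=> t; elim/repalg_ind=> r.
by rewrite !rep_addE; apply/repalg_piP; exact: rrel_addA.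
Qed.

Lemma rep_addC : commutative rep_add.
Proof.
elim/repalg_ind=> s; elim/repalg_ind=> t.
by rewrite !rep_addE; apply/repalg_piP; exact: rrel_addC.
Qed.

Lemma rep_add0 : left_id (\pi_repalg RZero) rep_add.
Proof. by elim/repalg_ind=> s; rewrite rep_addE; apply/repalg_piP/rrel_add0. Qed.

Lemma rep_scaleDl x : {morph rep_scale^~ x : c d / c + d >-> rep_add c d}.
Proof.
move=> c d; elim/repalg_ind: x => s.
by rewrite !rep_scaleE rep_addE; apply/repalg_piP/rrel_scaleDl.
Qed.

Lemma rep_scale1 : left_id 1 rep_scale.
Proof. by elim/repalg_ind=> s; rewrite rep_scaleE; apply/repalg_piP/rrel_scale1. Qed.

Lemma rep_addN : left_inverse (\pi_repalg RZero) (rep_scale (-1)) rep_add.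
Proof.
move=> x; rewrite -[X in rep_add _ X]rep_scale1 -rep_scaleDl addNr.
by elim/repalg_ind: x => s; rewrite rep_scaleE; apply/repalg_piP/rrel_scale0.
Qed.

HB.instance Definition _ := GRing.isZmodule.Build repalg
  rep_addA rep_addC rep_add0 rep_addN.

Lemma rep_scaleA c d x : rep_scale c (rep_scale d x) = rep_scale (c * d) x.
Proof.
by elim/repalg_ind: x => s; rewrite !rep_scaleE; apply/repalg_piP/rrel_scaleA.
Qed.

Lemma rep_scaleDr : right_distributive rep_scale rep_add.
Proof.
move=> c; elim/repalg_ind=> s; elim/repalg_ind=> t.
by rewrite !(rep_addE, rep_scaleE); apply/repalg_piP/rrel_scaleDr.
Qed.

HB.instance Definition _ := GRing.Zmodule_isLmodule.Build K repalg
  rep_scaleA rep_scale1 rep_scaleDr rep_scaleDl.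

Lemma rep_mulA : associative rep_mul.
Proof.
elim/repalg_ind=> s; elim/repalg_ind=> t; elim/repalg_ind=> r.
by rewrite !rep_mulE; apply/repalg_piP; exact: rrel_mulA.
Qed.

Lemma piD s t : \pi_repalg (RAdd s t) = \pi_repalg s + \pi_repalg t.
Proof. exact/esym/rep_addE. Qed.

Lemma piZ c s : \pi_repalg (RScale c s) = c *: \pi_repalg s.
Proof. exact/esym/rep_scaleE. Qed.

Lemma rep_mul_bilin : bilin rep_mul.
Proof.
split; elim/repalg_ind=> r c; elim/repalg_ind=> s; elim/repalg_ind=> t;
  rewrite -piZ -piD !rep_mulE -piZ -piD; apply/repalg_piP.
  apply: rrel_trans (rrel_mulDl _ _ _) _.
  by apply: rrel_add; [exact: rrel_mulZl | exact: rrel_refl].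
apply: rrel_trans (rrel_mulDr _ _ _) _.
by apply: rrel_add; [exact: rrel_mulZr | exact: rrel_refl].
Qed.

HB.instance Definition _ := Lmodule_isNUAlgebra.Build K repalg
  rep_mulA rep_mul_bilin.

Lemma piM s t : \pi_repalg (RMul s t) = \pi_repalg s ** \pi_repalg t.
Proof. exact/esym/rep_mulE. Qed.

Lemma pi_sum (I : Type) (F : I -> rterm) (s : seq I) :
  \pi_repalg (foldr RAdd RZero [seq F i | i <- s]) = \sum_(i <- s) \pi_repalg (F i).
Proof. by elim: s => [|i s IHs]; rewrite ?big_nil // big_cons -IHs -piD. Qed.

Definition rep_gen (a : A) (α : M) : repalg := \pi_repalg (RGen a α).

Lemma rep_gen_bilin : bilin rep_gen.
Proof.
split=> [α c a b|a c α β]; rewrite /rep_gen -piZ -piD; apply/repalg_piP.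
  exact: rrel_genl.
exact: rrel_genr.
Qed.

Lemma rep_genM a b α :
  rep_gen (a ** b) α = tlift (fun α1 α2 => rep_gen a α1 ** rep_gen b α2) (comul α).
Proof.
rewrite /tlift; under eq_bigr => p _ do rewrite -piM.
rewrite -pi_sum; apply/repalg_piP/rrel_genM.
by rewrite sweedlerE.
Qed.

Lemma rep_genC p q a b α β : homog p a -> homog q b ->
  rep_gen a α ** rep_gen b β = ksign K (p * q) *: (rep_gen b β ** rep_gen a α).
Proof.
move=> ha hb; rewrite -!piM -piZ; apply/repalg_piP; exact: rrel_genC.
Qed.

(* The homogeneous elements: the least family of submodules containing the    *)
(* homogeneous generators and compatible with products.                       *)
Inductive rep_homog : int -> repalg -> Prop :=
| rep_homog0 p : rep_homog p 0
| rep_homogP p c x y : rep_homog p x -> rep_homog p y -> rep_homog p (c *: x + y)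
| rep_homogM p q x y : rep_homog p x -> rep_homog q y -> rep_homog (p + q) (x ** y)
| rep_homog_gen p a α : homog p a -> rep_homog p (rep_gen a α).

Fixpoint rterm_decomp (t : rterm) : seq (int * repalg) :=
  match t with
  | RGen a α => [seq (i.1, rep_gen i.2 α) | i <- hdecomp a]
  | RZero => [::]
  | RAdd s t => rterm_decomp s ++ rterm_decomp t
  | RScale c s => [seq (i.1, c *: i.2) | i <- rterm_decomp s]
  | RMul s t =>
      [seq (i.1 + j.1, i.2 ** j.2) | i <- rterm_decomp s, j <- rterm_decomp t]
  end.

Lemma rterm_decompE t : \sum_(i <- rterm_decomp t) i.2 = \pi_repalg t.
Proof.
elim: t => [a α||s IHs t IHt|c s IHs|s IHs t IHt] /=.
- by rewrite big_map -(bilin_suml rep_gen_bilin) hdecompE.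
- by rewrite big_nil.
- by rewrite big_cat IHs IHt [RHS]piD.
- by rewrite big_map -scaler_sumr IHs -piZ.
- rewrite big_allpairs_dep /= piM -IHs -IHt (bilin_suml amul_bilin).
  by apply: eq_bigr => i _; rewrite (bilin_sumr amul_bilin).
Qed.

Lemma rterm_decomp_homog t i : i \in rterm_decomp t -> rep_homog i.1 i.2.
Proof.
elim: t i => [a α||s IHs t IHt|c s IHs|s IHs t IHt] i //=.
- by case/mapP=> j ja ->; apply: rep_homog_gen; exact: hdecomp_homog ja.
- by rewrite mem_cat => /orP[/IHs|/IHt].
- case/mapP=> j /IHs hj -> /=; rewrite -[c *: _]addr0.
  by apply: rep_homogP => //; exact: rep_homog0.
- by case/allpairsP=> -[j k] /= [/IHs hj /IHt hk ->]; exact: rep_homogM.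
Qed.

Definition coefM p (u v : seq (int * repalg)) : repalg :=
  coef p [seq (i.1 + j.1, i.2 ** j.2) | i <- u, j <- v].

Lemma coefME p u v : coefM p u v =
  \sum_(i <- u) \sum_(j <- v | i.1 + j.1 == p) i.2 ** j.2.
Proof.
rewrite /coefM /coef big_mkcond big_allpairs_dep /=.
by apply: eq_bigr => i _; rewrite -big_mkcond.
Qed.

Lemma coefM_l p u v :
  coefM p u v = \sum_(i <- u) i.2 ** coef (p - i.1) v.
Proof.
rewrite coefME; apply: eq_bigr => i _; rewrite /coef (bilin_sumr amul_bilin).
by apply: eq_bigl => j; rewrite addrC eq_sym -subr_eq eq_sym.
Qed.

Lemma coefM_r p u v :
  coefM p u v = \sum_(j <- v) coef (p - j.1) u ** j.2.
Proof.
rewrite coefME (exchange_big_dep xpredT) //=; apply: eq_bigr => j _.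
rewrite /coef (bilin_suml amul_bilin).
by apply: eq_bigl => i; rewrite eq_sym -subr_eq eq_sym.
Qed.

Lemma coefM_eq p u u' v v' : coef^~ u =1 coef^~ u' -> coef^~ v =1 coef^~ v' ->
  coefM p u v = coefM p u' v'.
Proof.
move=> eu ev; transitivity (coefM p u v').
  by rewrite !coefM_l; apply: eq_bigr => i _; rewrite ev.
by rewrite !coefM_r; apply: eq_bigr => i _; rewrite eu.
Qed.

Lemma coef_gen p a α : coef p (rterm_decomp (RGen a α)) = rep_gen (hcomp p a) α.
Proof. by rewrite /coef /= big_map -(bilin_suml rep_gen_bilin). Qed.

Lemma coef1 p q (x : repalg) : coef p [:: (q, x)] = if q == p then x else 0.
Proof. by rewrite /coef big_mkcond big_seq1. Qed.

Lemma coef_gen_homog q a α : homog q a ->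
  coef^~ (rterm_decomp (RGen a α)) =1 coef^~ [:: (q, rep_gen a α)].
Proof.
move=> ha p; rewrite coef_gen (hcomp_homog p ha) coef1; case: ifP => // _.
exact: (bilin0l rep_gen_bilin).
Qed.

Lemma coef_cat p (u v : seq (int * repalg)) : coef p (u ++ v) = coef p u + coef p v.
Proof. by rewrite /coef big_cat. Qed.

Lemma coef_scale p c (u : seq (int * repalg)) :
  coef p [seq (i.1, c *: i.2) | i <- u] = c *: coef p u.
Proof. by rewrite /coef big_map -scaler_sumr. Qed.

Lemma coef_rrel s t : rrel s t ->
  coef^~ (rterm_decomp s) =1 coef^~ (rterm_decomp t).
Proof.
elim=> {s t} /=.
- by [].
- by move=> s t _ st p; rewrite st.
- by move=> s t r _ st _ tr p; rewrite st tr.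
- by move=> s s' t t' _ es _ et p; rewrite !coef_cat es et.
- by move=> c s s' _ es p; rewrite !coef_scale es.
- by move=> s s' t t' _ es _ et p; exact: coefM_eq.
- by move=> s t r p; rewrite catA.
- by move=> s t p; rewrite !coef_cat addrC.
- by [].
- by move=> c d s p; rewrite !coef_scale scalerA.
- by move=> s p; rewrite coef_scale scale1r.
- by move=> s p; rewrite coef_scale scale0r /coef big_nil.
- by move=> c s t p; rewrite !(coef_scale, coef_cat) scalerDr.
- by move=> c d s p; rewrite !(coef_scale, coef_cat) scalerDl.
- move=> s t r p; rewrite -!/(coefM _ _ _) coefM_l coefM_r.
  under eq_bigr => i _ do rewrite -/(coefM _ _ _) coefM_r (bilin_sumr amul_bilin).
  rewrite exchange_big; apply: eq_bigr => j _ /=.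
  rewrite -/(coefM _ _ _) coefM_l (bilin_suml amul_bilin).
  by apply: eq_bigr => i _; rewrite amulA addrAC.
- move=> s t r p; rewrite coef_cat -!/(coefM _ _ _) !coefM_r -big_split.
  by apply: eq_bigr => i _; rewrite coef_cat (bilinDl amul_bilin).
- move=> s t r p; rewrite coef_cat -!/(coefM _ _ _) !coefM_l -big_split.
  by apply: eq_bigr => i _; rewrite coef_cat (bilinDr amul_bilin).
- move=> c s t p; rewrite coef_scale -!/(coefM _ _ _) !coefM_r scaler_sumr.
  by apply: eq_bigr => i _; rewrite coef_scale (bilinZl amul_bilin).
- move=> c s t p; rewrite coef_scale -!/(coefM _ _ _) !coefM_l scaler_sumr.
  by apply: eq_bigr => i _; rewrite coef_scale (bilinZr amul_bilin).
- move=> c a b α p.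
  rewrite coef_cat coef_scale -!/(rterm_decomp (RGen _ _)) !coef_gen hcomp_linear.
  by rewrite (bilinDl rep_gen_bilin) (bilinZl rep_gen_bilin).
- move=> c a α β p.
  rewrite coef_cat coef_scale -!/(rterm_decomp (RGen _ _)) !coef_gen.
  by rewrite (bilinDr rep_gen_bilin) (bilinZr rep_gen_bilin).
- move=> a b α s sE p; rewrite -/(rterm_decomp (RGen _ _)) coef_gen.
  rewrite (@hcompE _ _ p _
    [seq (i.1 + j.1, i.2 ** j.2) | i <- hdecomp a, j <- hdecomp b]).
  + have -> : coef p (rterm_decomp (foldr RAdd RZero
        [seq RMul (RGen a q.1) (RGen b q.2) | q <- s])) =
      \sum_(q <- s) \sum_(i <- hdecomp a) \sum_(j <- hdecomp b | i.1 + j.1 == p)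
        rep_gen i.2 q.1 ** rep_gen j.2 q.2.
      elim: {sE} s => [|q s IHs]; first by rewrite /coef !big_nil.
      rewrite big_cons -IHs /= coef_cat; congr (_ + _).
      rewrite -/(coefM _ _ _) coefME big_map; apply: eq_bigr => i _.
      by rewrite big_map.
    rewrite /coef [X in rep_gen X]big_mkcond big_allpairs_dep /= [RHS]exchange_big.
    rewrite (bilin_suml rep_gen_bilin); apply: eq_bigr => i _ /=.
    rewrite [RHS](exchange_big_dep (fun j => i.1 + j.1 == p)) //=.
    rewrite -big_mkcond (bilin_suml rep_gen_bilin).
    apply: eq_bigr => j ij; rewrite [RHS](eq_bigl xpredT) //.
    apply: etrans (rep_genM _ _ _) _; rewrite sE tlift_sum //; split=> [β c γ γ'|β c γ γ'].
      by rewrite (bilinDr rep_gen_bilin) (bilinZr rep_gen_bilin)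
        (bilinDl amul_bilin) (bilinZl amul_bilin).
    by rewrite (bilinDr rep_gen_bilin) (bilinZr rep_gen_bilin)
      (bilinDr amul_bilin) (bilinZr amul_bilin).
  + case=> _ _ /allpairsP[[i j] /= [ia jb [-> ->]]].
    by apply: homogM; [exact: hdecomp_homog ia | exact: hdecomp_homog jb].
  + rewrite big_allpairs_dep /= -[in LHS](hdecompE a) -[in LHS](hdecompE b).
    rewrite (bilin_suml amul_bilin); apply: eq_bigr => i _.
    by rewrite (bilin_sumr amul_bilin).
- move=> p q a b α β ha hb r; rewrite coef_scale -!/(coefM _ _ _).
  rewrite -!/(rterm_decomp (RGen _ _)).
  rewrite (coefM_eq _ (coef_gen_homog α ha) (coef_gen_homog β hb)).
  rewrite (coefM_eq _ (coef_gen_homog β hb) (coef_gen_homog α ha)).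
  rewrite /coefM !coef1 addrC (rep_genC α β ha hb).
  by case: ifP; rewrite ?scaler0.
Qed.

Definition rep_proj p (x : repalg) : repalg := coef p (rterm_decomp (repr x)).

Lemma rep_projE p s : rep_proj p (\pi_repalg s) = coef p (rterm_decomp s).
Proof. exact/coef_rrel/repalg_reprP. Qed.

Lemma rep_projP p c x y : rep_proj p (c *: x + y) = c *: rep_proj p x + rep_proj p y.
Proof.
elim/repalg_ind: x => s; elim/repalg_ind: y => t.
by rewrite -piZ -piD !rep_projE /= coef_cat coef_scale.
Qed.

Lemma rep_proj_homog p q x : rep_homog q x ->
  rep_proj p x = if q == p then x else 0.
Proof.
move=> hx; elim: hx p => {q x} [q|q c x y _ IHx _ IHy|q r x y _ IHx _ IHy|q a α ha] p.
- by rewrite rep_projE /coef big_nil if_same.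
- by rewrite rep_projP IHx IHy; case: ifP; rewrite ?scaler0 ?addr0.
- move: x y IHx IHy; elim/repalg_ind=> s; elim/repalg_ind=> t IHs IHt.
  rewrite -piM rep_projE /= -/(coefM _ _ _) piM.
  rewrite (@coefM_eq p _ [:: (q, \pi_repalg s)] _ [:: (r, \pi_repalg t)]).
  + by rewrite /coefM coef1.
  + by move=> m; rewrite coef1 -IHs rep_projE.
  + by move=> m; rewrite coef1 -IHt rep_projE.
- by rewrite rep_projE (coef_gen_homog α ha) coef1.
Qed.

Lemma rep_homog_decomp x : exists s : seq (int * repalg),
  (forall i, i \in s -> rep_homog i.1 i.2) /\ x = \sum_(i <- s) i.2.
Proof.
elim/repalg_ind: x => t; exists (rterm_decomp t).
by split=> [i|]; [exact: rterm_decomp_homog | rewrite rterm_decompE].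
Qed.

Lemma rep_homog_direct (S : seq int) (f : int -> repalg) : uniq S ->
  (forall p, p \in S -> rep_homog p (f p)) ->
  \sum_(p <- S) f p = 0 -> forall p, p \in S -> f p = 0.
Proof.
move=> uS fS f0 p pS.
have p0 : rep_proj p 0 = 0 by rewrite rep_projE /coef big_nil.
have pD x y : rep_proj p (x + y) = rep_proj p x + rep_proj p y.
  by rewrite -[x]scale1r rep_projP !scale1r.
move: (congr1 (rep_proj p) f0).
rewrite (big_morph (rep_proj p) pD p0) p0 (big_rem _ pS) /=.
rewrite (rep_proj_homog p (fS p pS)) eqxx big1_seq ?addr0 // => q /= qS.
rewrite (rep_proj_homog p (fS q (mem_rem qS))).
by case: eqP => // qp; rewrite qp mem_rem_uniqF in qS.
Qed.

HB.instance Definition _ := NUAlgebra_isGraded.Build K repalg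
  rep_homog0 rep_homogP rep_homogM rep_homog_decomp rep_homog_direct.

End RepAlgebraTerms.


Definition trilin (K : pzRingType) (U V W X : lmodType K) (f : U -> V -> W -> X) :=
  (forall w, bilin (fun u v => f u v w)) /\ (forall u v, linear (f u v)).

Section Tlift3Theory.
Variables (K : comPzRingType) (U V W X : lmodType K) (f : U -> V -> W -> X).
Hypothesis fT : trilin f.

Lemma tlift3_bilin : bilin (fun y w => tlift (fun u v => f u v w) y).
Proof.
split=> [w|y c w w']; first exact: tlift_linear (fT.1 w).
rewrite /tlift scaler_sumr -big_split; apply: eq_bigr => p _.
exact: fT.2.
Qed.

Lemma tlift3_linear : linear (tlift3 f).
Proof. exact: tlift_linear tlift3_bilin. Qed.

Lemma tlift3_pure2 y w : tlift3 f (y ⊗ w) = tlift (fun u v => f u v w) y.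
Proof. exact: tlift_pure tlift3_bilin _ _. Qed.

Lemma tlift3_pure u v w : tlift3 f (u ⊗ v ⊗ w) = f u v w.
Proof. by rewrite tlift3_pure2 tlift_pure //; exact: fT.1. Qed.

Lemma tlift3_sum (I : Type) (s : seq I) F :
  tlift3 f (\sum_(i <- s) F i) = \sum_(i <- s) tlift3 f (F i).
Proof.
have fD x y : tlift3 f (x + y) = tlift3 f x + tlift3 f y.
  by have := tlift3_linear 1 x y; rewrite !scale1r.
apply: (big_morph _ fD); apply: (addrI (tlift3 f 0)).
by rewrite -fD !addr0.
Qed.

End Tlift3Theory.

Section TensorMap.
Variables (K : comPzRingType) (U V U' V' : lmodType K).
Variables (f : {linear U -> U'}) (g : {linear V -> V'}).

Definition tmap : tensor U V -> tensor U' V' := tlift (fun u v => f u ⊗ g v).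

Lemma tmap_bilin : bilin (fun u v => f u ⊗ g v).
Proof.
have tB := @tensor_pure_bilin K U' V'.
split=> [v c u u'|u c v v']; rewrite linearP.
  by rewrite (bilinDl tB) (bilinZl tB).
by rewrite (bilinDr tB) (bilinZr tB).
Qed.

HB.instance Definition _ := GRing.isLinear.Build K _ _ _ tmap (tlift_linear tmap_bilin).

Lemma tmap_pure u v : tmap (u ⊗ v) = f u ⊗ g v.
Proof. exact: tlift_pure tmap_bilin _ _. Qed.

Lemma tmap_sum (s : seq (U * V)) :
  tmap (\sum_(p <- s) p.1 ⊗ p.2) = \sum_(p <- s) f p.1 ⊗ g p.2.
Proof. by rewrite linear_sum; apply: eq_bigr => p _; exact: tmap_pure. Qed.

End TensorMap.

Section UnitAction.
Variables (K : comPzRingType) (M : counitalCoalgType K).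
Implicit Types (φ ψ : {scalar M}) (α : M).

Let tB := @tensor_pure_bilin K M M.
Let sw α := sweedler (comul α).

Lemma comul_sw α : comul α = \sum_(p <- sw α) p.1 ⊗ p.2.
Proof. by rewrite sweedlerE. Qed.

(* α ↦ φ(α¹) α² and α ↦ φ(α²) α¹ *)
Definition lact φ : M -> M := tlift (fun β γ => φ β *: γ) \o comul.
Definition ract φ : M -> M := tlift (fun β γ => φ γ *: β) \o comul.

Lemma lact_bilin φ : bilin (fun β γ : M => φ β *: γ).
Proof.
by split=> [v c u u'|u c v v'];
  rewrite ?linearP ?scalerDl ?scalerDr ?scalerA // mulrC.
Qed.

Lemma ract_bilin φ : bilin (fun β γ : M => φ γ *: β).
Proof.
by split=> [v c u u'|u c v v'];
  rewrite ?linearP ?scalerDl ?scalerDr ?scalerA // mulrC.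
Qed.

Lemma lact_linear φ : linear (lact φ).
Proof. by move=> c x y; rewrite /lact /= linearP tlift_linear //; exact: lact_bilin. Qed.

Lemma ract_linear φ : linear (ract φ).
Proof. by move=> c x y; rewrite /ract /= linearP tlift_linear //; exact: ract_bilin. Qed.

HB.instance Definition _ φ := GRing.isLinear.Build K _ _ _ (lact φ) (lact_linear φ).
HB.instance Definition _ φ := GRing.isLinear.Build K _ _ _ (ract φ) (ract_linear φ).

Lemma coassoc_sum (W : lmodType K) (f : M -> M -> M -> W) α : trilin f ->
  \sum_(p <- sw α) \sum_(q <- sw p.1) f q.1 q.2 p.2 =
  \sum_(p <- sw α) \sum_(q <- sw p.2) f p.1 q.1 q.2.
Proof.
move=> fT; have := congr1 (tlift3 f) (comulA α).
rewrite !(tlift3_sum fT) => e.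
transitivity (\sum_(p <- sw α) tlift3 f (comul p.1 ⊗ p.2)).
  by apply: eq_bigr => p _; rewrite (tlift3_pure2 fT).
rewrite e; apply: eq_bigr => p _; rewrite (tlift3_sum fT).
by apply: eq_bigr => q _; rewrite (tlift3_pure fT).
Qed.

Lemma comul3_sum (W : lmodType K) (f : M -> M -> M -> W) α : trilin f ->
  tlift3 f (comul3 α) = \sum_(p <- sw α) \sum_(q <- sw p.1) f q.1 q.2 p.2.
Proof.
move=> fT; rewrite /comul3 (tlift3_sum fT).
by apply: eq_bigr => p _; rewrite (tlift3_pure2 fT).
Qed.

Lemma comul_lact φ α : comul (lact φ α) = \sum_(p <- sw α) lact φ p.1 ⊗ p.2.
Proof.
have fT : trilin (fun a b c : M => φ a *: (b ⊗ c)).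
  split=> [w|u v c w w'].
    split=> [v c u u'|u c v v'].
      by rewrite linearP scalerDl scalerA.
    by rewrite (bilinDl tB) (bilinZl tB) scalerDr !scalerA mulrC.
  by rewrite (bilinDr tB) (bilinZr tB) scalerDr !scalerA mulrC.
have := coassoc_sum α fT.
rewrite {1}/lact /= /tlift linear_sum => e.
transitivity (\sum_(p <- sw α) \sum_(q <- sw p.2) φ p.1 *: (q.1 ⊗ q.2)).
  by apply: eq_bigr => p _; rewrite linearZZ comul_sw scaler_sumr.
rewrite -e; apply: eq_bigr => p _.
rewrite /lact /= /tlift (bilin_suml tB).
by apply: eq_bigr => q _; rewrite (bilinZl tB).
Qed.

Lemma comul_ract φ α : comul (ract φ α) = \sum_(p <- sw α) p.1 ⊗ ract φ p.2.
Proof.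
have fT : trilin (fun a b c : M => φ c *: (a ⊗ b)).
  split=> [w|u v c w w'].
    split=> [v c u u'|u c v v'].
      by rewrite (bilinDl tB) (bilinZl tB) scalerDr !scalerA mulrC.
    by rewrite (bilinDr tB) (bilinZr tB) scalerDr !scalerA mulrC.
  by rewrite linearP scalerDl scalerA.
have := coassoc_sum α fT.
rewrite {1}/ract /= /tlift linear_sum => e.
transitivity (\sum_(p <- sw α) \sum_(q <- sw p.1) φ p.2 *: (q.1 ⊗ q.2)).
  by apply: eq_bigr => p _; rewrite linearZZ comul_sw scaler_sumr.
rewrite e; apply: eq_bigr => p _.
rewrite /ract /= /tlift (bilin_sumr tB).
by apply: eq_bigr => q _; rewrite (bilinZr tB).
Qed.

Lemma ract_lact_tensor φ α :
  \sum_(p <- sw α) ract φ p.1 ⊗ p.2 = \sum_(p <- sw α) p.1 ⊗ lact φ p.2.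
Proof.
have fT : trilin (fun a b c : M => φ b *: (a ⊗ c)).
  split=> [w|u v c w w'].
    split=> [v c u u'|u c v v'].
      by rewrite (bilinDl tB) (bilinZl tB) scalerDr !scalerA mulrC.
    by rewrite linearP scalerDl scalerA.
  by rewrite (bilinDr tB) (bilinZr tB) scalerDr !scalerA mulrC.
have e := coassoc_sum α fT.
transitivity (\sum_(p <- sw α) \sum_(q <- sw p.1) φ q.2 *: (q.1 ⊗ p.2)).
  apply: eq_bigr => p _; rewrite /ract /= /tlift (bilin_suml tB).
  by apply: eq_bigr => q _; rewrite (bilinZl tB).
rewrite e; apply: eq_bigr => p _; rewrite /lact /= /tlift (bilin_sumr tB).
by apply: eq_bigr => q _; rewrite (bilinZr tB).
Qed.

Lemma lact_comp φ ψ : conv ψ φ =1 counit -> forall α, lact φ (lact ψ α) = α.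
Proof.
move=> e α; rewrite {1}/lact /= comul_lact (tlift_sumI (lact_bilin φ)).
rewrite -[RHS]counitl; apply: eq_bigr => p _; congr (_ *: _).
rewrite -e /conv /lact /= /tlift linear_sum; apply: eq_bigr => q _.
by rewrite scalarZ.
Qed.

Lemma ract_lact φ ψ α : ract ψ (lact φ α) = lact φ (ract ψ α).
Proof.
rewrite {1}/ract /= comul_lact (tlift_sumI (ract_bilin ψ)).
rewrite /ract /= /tlift linear_sum; apply: eq_bigr => p _.
by rewrite linearZZ.
Qed.

Lemma unit_actE (u : dual_unit M) α : unit_act u α = lact (dual_inv u) (ract u α).
Proof.
rewrite /unit_act comul3_sum; last first.
  split=> [w|v w c a a'].
    split=> [v c a a'|a c v v'].
      by rewrite linearP mulrDl scalerDl scalerA mulrA.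
    by rewrite scalerDr !scalerA mulrC.
  by rewrite linearP mulrDr scalerDl scalerA mulrCA.
rewrite [in RHS]/ract /= /tlift linear_sum; apply: eq_bigr => p _.
rewrite linearZZ /lact /= /tlift scaler_sumr; apply: eq_bigr => q _.
by rewrite scalerA mulrC.
Qed.

Lemma unit_act_linear (u : dual_unit M) : linear (unit_act u).
Proof. by move=> c x y; rewrite !unit_actE !linearP. Qed.

HB.instance Definition _ (u : dual_unit M) :=
  GRing.isLinear.Build K _ _ _ (unit_act u) (unit_act_linear u).

Lemma comul_unit_act (u : dual_unit M) α :
  comul (unit_act u α) = \sum_(p <- sw α) unit_act u p.1 ⊗ unit_act u p.2.
Proof.
pose L := lact (dual_inv u); pose R := ract u.
have LE β : comul (L β) = tmap L idfun (comul β).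
  by rewrite comul_lact [in RHS]comul_sw tmap_sum.
have RE β : comul (R β) = tmap idfun R (comul β).
  by rewrite comul_ract [in RHS]comul_sw tmap_sum.
rewrite unit_actE -/L -/R LE RE {1}comul_sw tmap_sum.
rewrite linear_sum /=.
have -> : \sum_(p <- sw α) tmap L idfun (p.1 ⊗ R p.2) =
    tmap L R (\sum_(p <- sw α) p.1 ⊗ lact (dual_inv u) (lact u p.2)).
  rewrite linear_sum; apply: eq_bigr => p _.
  by rewrite tmap_pure [RHS]tmap_pure /= (lact_comp (@dual_valK _ _ u)).
have -> : \sum_(p <- sw α) p.1 ⊗ lact (dual_inv u) (lact u p.2) =
    \sum_(p <- sw α) R p.1 ⊗ L p.2.
  transitivity (tmap idfun L (\sum_(p <- sw α) p.1 ⊗ lact u p.2)).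
    by rewrite linear_sum; apply: eq_bigr => p _; rewrite /= tmap_pure.
  rewrite -ract_lact_tensor linear_sum; apply: eq_bigr => p _.
  by rewrite /= tmap_pure.
rewrite linear_sum; apply: eq_bigr => p _; rewrite /= tmap_pure !unit_actE.
by rewrite -/L -/R [in RHS]/R [in RHS]/L; congr (_ ⊗ _); rewrite /R /L -ract_lact.
Qed.

End UnitAction.


Section RepLift.
Variables (K : comPzRingType) (A : galgType K) (M : coalgType K) (B : nuAlgType K).
Variable g : A -> M -> B.

Fixpoint rterm_eval (t : rterm A M) : B :=
  match t with
  | RGen a α => g a α
  | RZero => 0
  | RAdd s t => rterm_eval s + rterm_eval t
  | RScale c s => c *: rterm_eval s
  | RMul s t => rterm_eval s ** rterm_eval t
  end.

(* The algebra morphism sending each generator a_α to [g a α]; it is well     *)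
(* defined when g respects the defining relations.                            *)
Definition rep_lift (x : repalg A M) : B := rterm_eval (repr x).

Record rep_compat : Prop := RepCompat {
  rep_compat_bilin : bilin g;
  rep_compatM : forall a b α (s : seq (M * M)), comul α = \sum_(p <- s) p.1 ⊗ p.2 ->
    g (a ** b) α = \sum_(p <- s) g a p.1 ** g b p.2;
  rep_compatC : forall p q a b α β, homog p a -> homog q b ->
    g a α ** g b β = ksign K (p * q) *: (g b β ** g a α)
}.

Hypothesis gP : rep_compat.

Lemma rterm_eval_rrel s t : rrel s t -> rterm_eval s = rterm_eval t.
Proof.
have mB := @amul_bilin _ B; have gB := rep_compat_bilin gP.
elim=> {s t} //=.
- by move=> s t r _ -> _ ->.
- by move=> s s' t t' _ -> _ ->.
- by move=> c s s' _ ->.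
- by move=> s s' t t' _ -> _ ->.
- by move=> *; rewrite addrA.
- by move=> *; rewrite addrC.
- by move=> *; rewrite add0r.
- by move=> *; rewrite scalerA.
- by move=> *; rewrite scale1r.
- by move=> *; rewrite scale0r.
- by move=> *; rewrite scalerDr.
- by move=> *; rewrite scalerDl.
- by move=> *; rewrite amulA.
- by move=> *; rewrite (bilinDl mB).
- by move=> *; rewrite (bilinDr mB).
- by move=> *; rewrite (bilinZl mB).
- by move=> *; rewrite (bilinZr mB).
- by move=> *; rewrite (bilinDl gB) (bilinZl gB).
- by move=> *; rewrite (bilinDr gB) (bilinZr gB).
- move=> a b α s /(rep_compatM gP) ->.
  by elim: s => [|p s IHs]; rewrite ?big_nil // big_cons IHs.
- by move=> p q a b α β ha hb; exact: rep_compatC.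
Qed.

Lemma rep_liftE t : rep_lift (\pi_(repalg A M) t) = rterm_eval t.
Proof. exact/rterm_eval_rrel/repalg_reprP. Qed.

Lemma rep_lift_gen a α : rep_lift (rep_gen a α) = g a α.
Proof. exact: rep_liftE. Qed.

Lemma rep_lift_linear : linear rep_lift.
Proof.
move=> c x y; elim/repalg_ind: x => s; elim/repalg_ind: y => t.
by rewrite -piZ -piD !rep_liftE.
Qed.

Lemma rep_liftM x y : rep_lift (x ** y) = rep_lift x ** rep_lift y.
Proof.
elim/repalg_ind: x => s; elim/repalg_ind: y => t.
by rewrite -piM !rep_liftE.
Qed.

End RepLift.

Lemma rep_endo_compat (K : comPzRingType) (A : galgType K) (M : coalgType K)
    (h : {linear M -> M}) : (forall α, comul (h α) = tmap h h (comul α)) ->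
  rep_compat (fun (a : A) (α : M) => rep_gen a (h α)).
Proof.
have gB := @rep_gen_bilin K A M; have mB := @amul_bilin K (repalg A M).
move=> hP; split=> [|a b α s sE|p q a b α β]; last exact: rep_genC.
  split=> [α|a c α β]; first exact: gB.1.
  by rewrite linearP; exact: gB.2.
have B (a' b' : A) : bilin (fun β γ : M => rep_gen a' β ** rep_gen b' γ).
  split=> [v c β β'|v c β β'].
    by rewrite (bilinDr gB) (bilinZr gB) (bilinDl mB) (bilinZl mB).
  by rewrite (bilinDr gB) (bilinZr gB) (bilinDr mB) (bilinZr mB).
by rewrite rep_genM hP sE tmap_sum (tlift_sumI (B a b)).
Qed.

Section RepAction.
Variables (K : comPzRingType) (A : galgType K) (M : counitalCoalgType K).
Variable u : dual_unit M.

Definition rep_act : repalg A M -> repalg A M :=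
  rep_lift (fun a α => rep_gen a (unit_act u α)).

Lemma rep_act_compat :
  rep_compat (fun (a : A) (α : M) => rep_gen a (unit_act u α)).
Proof.
apply: (@rep_endo_compat K A M (unit_act u)) => α.
by rewrite comul_unit_act -[in RHS](sweedlerE (comul α)) tmap_sum.
Qed.

Lemma rep_act_gen a α : rep_act (rep_gen a α) = rep_gen a (unit_act u α).
Proof. exact: rep_lift_gen rep_act_compat _ _. Qed.

Lemma rep_act_linear : linear rep_act.
Proof. exact: rep_lift_linear rep_act_compat. Qed.

Lemma rep_actM x y : rep_act (x ** y) = rep_act x ** rep_act y.
Proof. exact: rep_liftM rep_act_compat _ _. Qed.

Lemma rep_act_homog p x : homog p x -> homog p (rep_act x).
Proof.
have r0 : rep_act 0 = 0.
  apply: (addIr (rep_act 0)); rewrite add0r -[X in X + _]scale1r.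
  by rewrite -rep_act_linear scale1r addr0.
elim=> {p x} [p|p c x y _ hx _ hy|p q x y _ hx _ hy|p a α ha].
- by rewrite r0; exact: homog0.
- by rewrite rep_act_linear; exact: homogP.
- by rewrite rep_actM; exact: homogM.
- by rewrite rep_act_gen; exact: rep_homog_gen.
Qed.

End RepAction.

Section InducedBracket.
Variables (K : comPzRingType) (A : galgType K).

Definition induced_bracket (M : coalgType K) (n : int)
    (D : {linear tensor A A -> tensor A A}) (v : {scalar tensor M M})
    (br : {linear tensor (repalg A M) (repalg A M) -> repalg A M}) : Prop :=
  biderivation n br /\
  forall (a b : A) (α β : M),
    br (rep_gen a α ⊗ rep_gen b β) =
    tlift3 (fun β1 β2 β3 => v (α ⊗ β2) *:
      tlift (fun x y => rep_gen x β1 ** rep_gen y β3) (D (a ⊗ b))) (comul3 β).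

Definition rep_fixed (M : counitalCoalgType K) (x : repalg A M) : Prop :=
  forall u : dual_unit M, rep_act u x = x.

End InducedBracket.

(* Main.v *)
From HB Require Import structures.
Require Import Defs.
From mathcomp Require Import all_boot all_order all_algebra.

(** Write [φ·α·ψ] for [φ(α¹) ψ(α³) α²], where [φ] and [ψ] are linear forms on
    the coalgebra [M]; the formal counterpart is [lact φ (ract ψ α)].
    Evaluating the cyclicity identity at [α ⊗ β] and pairing the result with
    [φ ⊗ ψ] gives the exchange law

      [v (β ⊗ φ·α·ψ) = v (α ⊗ ψ·β·φ)]

    of [cyclic_form_exchange], from which everything about [v] follows. For
    [φ = ψ = counit] it says that [v] is symmetric. Since [u] acts on [M] by
    [α ↦ u⁻¹·α·u], taking [φ = u⁻¹] and [ψ = u] shows that [u] and [u⁻¹] are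
    adjoint for [v], so [v] is invariant under [U] ([cyclic_form_invariant]).

    The action of [u] on [M] respects comultiplication. Hence, for two
    generators [a_α], [b_β], applying [u] inside the bracket changes the
    defining formula only by replacing [v (α ⊗ β²)] with
    [v (u α ⊗ u β²)], and invariance of [v] shows that [u] preserves the
    bracket on generators. Because [u] acts on [A_M] by graded algebra
    automorphisms, the set of pairs on which it preserves the bracket is
    closed under linear combinations and, by the Leibniz rules, under products
    of homogeneous elements in either variable; homogeneous generators
    therefore suffice. Closure of the fixed points is then immediate. *)

Set Implicit Arguments.
Unset Strict Implicit.
Unset Printing Implicit Defensive.

Import GRing.Theory.

Local Open Scope ring_scope.

(** * Two-sided contraction of the comultiplication *)

Section Contraction.
Variables (K : comPzRingType) (M : counitalCoalgType K).
Implicit Types (φ ψ : {scalar M}) (α : M).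

Lemma lact_counit α : lact (@counit K M) α = α.
Proof. exact: counitl. Qed.

Lemma ract_counit α : ract (@counit K M) α = α.
Proof. exact: counitr. Qed.

Lemma ract_comp φ ψ : conv φ ψ =1 counit -> forall α, ract φ (ract ψ α) = α.
Proof.
move=> e α; rewrite {1}/ract /= comul_ract (tlift_sumI (ract_bilin φ)).
rewrite -[RHS]counitr; apply: eq_bigr => p _; congr (_ *: _).
rewrite -e /conv /ract /= /tlift linear_sum; apply: eq_bigr => q _.
by rewrite scalarZ mulrC.
Qed.

Lemma contract_trilin φ ψ :
  trilin (fun α1 α2 α3 : M => (φ α1 * ψ α3) *: α2).
Proof.
split=> [w|v w c a a'].
  split=> [v c a a'|a c v v'].
    by rewrite linearP mulrDl scalerDl scalerA mulrA.
  by rewrite scalerDr !scalerA mulrC.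
by rewrite linearP mulrDr scalerDl scalerA mulrCA.
Qed.

Lemma contractE φ ψ α :
  tlift3 (fun α1 α2 α3 => (φ α1 * ψ α3) *: α2) (comul3 α) =
  lact φ (ract ψ α).
Proof.
rewrite (comul3_sum _ (contract_trilin φ ψ)).
rewrite [in RHS]/ract /= /tlift linear_sum; apply: eq_bigr => p _.
rewrite linearZZ /lact /= /tlift scaler_sumr; apply: eq_bigr => q _.
by rewrite scalerA mulrC.
Qed.

(** Left and right contractions commute, so the two sides cancel separately. *)
Lemma unit_actK (u : dual_unit M) α :
  lact u (ract (dual_inv u) (unit_act u α)) = α.
Proof.
rewrite unit_actE ract_lact (lact_comp (@dual_invK _ _ u)).
exact: ract_comp (@dual_invK _ _ u) _.
Qed.

End Contraction.

(** * Cyclic forms *)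

Section CyclicForms.
Variables (K : comPzRingType) (M : counitalCoalgType K).
Variable v : {scalar tensor M M}.
Implicit Types (φ ψ : {scalar M}) (α β : M).

Let tB := @tensor_pure_bilin K M M.

Lemma form_hat_trilin α :
  trilin (fun β1 β2 β3 : M => v (α ⊗ β2) *: (β1 ⊗ β3)).
Proof.
split=> [w|x w c a a'].
  split=> [x c a a'|a c x x'].
    by rewrite (bilinDl tB) (bilinZl tB) scalerDr !scalerA mulrC.
  by rewrite (bilinDr tB) (bilinZr tB) linearP scalerDl scalerA.
by rewrite (bilinDr tB) (bilinZr tB) scalerDr !scalerA mulrC.
Qed.

Lemma comul_pure_bilin : bilin (fun β γ : M => comul β ⊗ γ).
Proof.
have tB' := @tensor_pure_bilin K (tensor M M) M.
split=> [x c a a'|a c x x'].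
  by rewrite linearP (bilinDl tB') (bilinZl tB').
by rewrite (bilinDr tB') (bilinZr tB').
Qed.

Lemma comul3_linear : linear (@comul3 K M).
Proof.
by move=> c x y; rewrite /comul3 linearP (tlift_linear comul_pure_bilin).
Qed.

Lemma form_hat_pure α β : form_hat v (α ⊗ β) =
  tlift3 (fun β1 β2 β3 => v (α ⊗ β2) *: (β1 ⊗ β3)) (comul3 β).
Proof.
rewrite /form_hat tlift_pure //; split=> [x c a a'|a c x x'].
  rewrite !(comul3_sum _ (form_hat_trilin _)) scaler_sumr -big_split.
  apply: eq_bigr => p _ /=; rewrite scaler_sumr -big_split.
  apply: eq_bigr => q _ /=.
  by rewrite (bilinDl tB) (bilinZl tB) linearP scalerDl scalerA.
by rewrite comul3_linear (tlift3_linear (form_hat_trilin _)).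
Qed.

Lemma dual_tensor_bilin φ ψ : bilin (fun x y : M => φ x * ψ y : K^o).
Proof.
split=> [y c a a'|x c a a'].
  by rewrite linearP mulrDl -mulrA.
by rewrite linearP mulrDr [in LHS]mulrCA.
Qed.

Lemma dual_form_hat φ ψ α β :
  tlift (W := K^o) (fun x y => φ x * ψ y) (form_hat v (α ⊗ β)) =
  v (α ⊗ lact φ (ract ψ β)).
Proof.
have dB := dual_tensor_bilin φ ψ.
pose F := GRing.isLinear.Build K _ _ _ _ (tlift_linear dB).
pose f : {linear tensor M M -> K^o} := HB.pack (tlift _) F.
transitivity (f (form_hat v (α ⊗ β))); first by [].
rewrite form_hat_pure (comul3_sum _ (form_hat_trilin α)).
rewrite -contractE (comul3_sum _ (contract_trilin φ ψ)).
rewrite (bilin_sumr tB) !linear_sum; apply: eq_bigr => p _.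
rewrite (bilin_sumr tB) !linear_sum; apply: eq_bigr => q _.
rewrite (bilinZr tB) linearZZ scalarZ [f _](tlift_pure dB).
exact: mulrC.
Qed.

Lemma dual_flip φ ψ x :
  tlift (W := K^o) (fun x y => φ x * ψ y) (flip x) =
  tlift (W := K^o) (fun x y => ψ x * φ y) x.
Proof.
rewrite /flip {2}/tlift (tlift_sumI (dual_tensor_bilin φ ψ)).
by apply: eq_bigr => p _; rewrite mulrC.
Qed.

Hypothesis v_cyclic : cyclic_form v.

(** This is the cyclicity identity paired with [φ ⊗ ψ]; it turns an identity
    in [M ⊗ M] into an adjunction between contractions. *)
Lemma cyclic_form_exchange φ ψ α β :
  v (β ⊗ lact φ (ract ψ α)) = v (α ⊗ lact ψ (ract φ β)).
Proof.
have fE : flip (α ⊗ β) = β ⊗ α.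
  rewrite /flip tlift_pure //; split=> [x c a a'|a c x x'].
    by rewrite (bilinDr tB) (bilinZr tB).
  by rewrite (bilinDl tB) (bilinZl tB).
by rewrite -!dual_form_hat -fE v_cyclic dual_flip.
Qed.

Lemma cyclic_form_sym α β : v (α ⊗ β) = v (β ⊗ α).
Proof.
have := cyclic_form_exchange counit counit β α.
by rewrite !ract_counit !lact_counit.
Qed.

(** By the exchange law the contraction [u⁻¹·α·u] moves to the other argument
    as [u·(u β)·u⁻¹], which undoes the action of [u] on [β]. *)
Lemma cyclic_form_invariant (u : dual_unit M) α β :
  v (unit_act u α ⊗ unit_act u β) = v (α ⊗ β).
Proof.
by rewrite cyclic_form_sym [unit_act u α]unit_actE cyclic_form_exchange unit_actK.
Qed.

End CyclicForms.

(** * Invariance of the induced bracket *)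

HB.instance Definition _ (K : comPzRingType) (A : galgType K)
    (M : counitalCoalgType K) (u : dual_unit M) :=
  GRing.isLinear.Build K _ _ _ (@rep_act K A M u) (rep_act_linear u).

Lemma comul3_unit_act (K : comPzRingType) (M : counitalCoalgType K)
    (W : lmodType K) (f : M -> M -> M -> W) (u : dual_unit M) (β : M) :
  trilin f ->
  tlift3 f (comul3 (unit_act u β)) =
  tlift3 (fun x y z => f (unit_act u x) (unit_act u y) (unit_act u z))
    (comul3 β).
Proof.
move=> fT; have fuT : trilin (fun x y z : M =>
    f (unit_act u x) (unit_act u y) (unit_act u z)).
  split=> [w|x y c z z']; last by rewrite linearP fT.2.
  split=> [y c x x'|x c y y']; rewrite linearP.
    exact: (fT.1 _).1.
  exact: (fT.1 _).2.
rewrite (comul3_sum _ fuT) /comul3 comul_unit_act.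
rewrite (tlift_sumI (@comul_pure_bilin K M)) (tlift3_sum fT).
apply: eq_bigr => p _; rewrite (tlift3_pure2 fT) comul_unit_act.
by rewrite (tlift_sumI (fT.1 _)).
Qed.

(** The Leibniz rules reduce an equality of two brackets to generators. A
    biderivation controls only products of homogeneous elements, hence the
    induction runs over homogeneous elements and general ones are reached by
    decomposing them. *)
Lemma biderivation_equivariant (K : comPzRingType) (A : galgType K)
    (M : counitalCoalgType K) (n : int) (u : dual_unit M)
    (br : {linear tensor (repalg A M) (repalg A M) -> repalg A M}) :
  biderivation n br ->
  (forall (a b : A) (α β : M),
    br (rep_act u (rep_gen a α) ⊗ rep_act u (rep_gen b β)) =
    rep_act u (br (rep_gen a α ⊗ rep_gen b β))) ->
  forall x y : repalg A M,
    br (rep_act u x ⊗ rep_act u y) = rep_act u (br (x ⊗ y)).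
Proof.
move=> bd gen; have tB := @tensor_pure_bilin K (repalg A M) (repalg A M).
have right_gen p a α q (y : repalg A M) : homog p a -> homog q y ->
    br (rep_act u (rep_gen a α) ⊗ rep_act u y) =
    rep_act u (br (rep_gen a α ⊗ y)).
  move=> ha; have hg : homog p (rep_gen a α) by exact: rep_homog_gen.
  elim=> {q y} [q|q c x y _ IHx _ IHy|q r x y hx IHx hy IHy|q b β _].
  - by rewrite linear0 !(bilin0r tB) !linear0.
  - rewrite linearP !(bilinDr tB) !(bilinZr tB) linearP IHx IHy.
    by rewrite -linearP -linearP.
  - rewrite rep_actM (bider_der_r bd (rep_act_homog u hg) (rep_act_homog u hx)
      (rep_act_homog u hy)) (bider_der_r bd hg hx hy).
    by rewrite linearD linearZZ /= !rep_actM IHx IHy.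
  - exact: gen.
have hom p q (x y : repalg A M) : homog p x -> homog q y ->
    br (rep_act u x ⊗ rep_act u y) = rep_act u (br (x ⊗ y)).
  move=> hx hy.
  elim: hx => {p x} [p|p c x x' _ IHx _ IHy|p r x x' hx IHx hx' IHy|p a α ha].
  - by rewrite linear0 !(bilin0l tB) !linear0.
  - rewrite linearP !(bilinDl tB) !(bilinZl tB) linearP IHx IHy.
    by rewrite -linearP -linearP.
  - rewrite rep_actM (bider_der_l bd (rep_act_homog u hx) (rep_act_homog u hx')
      (rep_act_homog u hy)) (bider_der_l bd hx hx' hy).
    by rewrite linearD linearZZ /= !rep_actM IHx IHy.
  - exact: right_gen ha hy.
move=> x y; rewrite -(hdecompE x) -(hdecompE y).
rewrite !linear_sum !(bilin_suml tB) !linear_sum big_seq [RHS]big_seq.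
apply: eq_bigr => i xi.
rewrite !(bilin_sumr tB) !linear_sum big_seq [RHS]big_seq.
apply: eq_bigr => j yj.
by apply: hom (hdecomp_homog xi) (hdecomp_homog yj).
Qed.

(** After [comul3_unit_act] both sides are sums over the same iterated
    comultiplication of [β], and they differ only in the coefficients
    [v (u α ⊗ u β²)] and [v (α ⊗ β²)]. *)
Lemma induced_bracket_gen (K : comPzRingType) (A : galgType K) (n : int)
    (D : {linear tensor A A -> tensor A A}) (M : counitalCoalgType K)
    (v : {scalar tensor M M})
    (br : {linear tensor (repalg A M) (repalg A M) -> repalg A M})
    (u : dual_unit M) (a b : A) (α β : M) :
  cyclic_form v -> induced_bracket n D v br ->
  br (rep_act u (rep_gen a α) ⊗ rep_act u (rep_gen b β)) =
  rep_act u (br (rep_gen a α ⊗ rep_gen b β)).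
Proof.
move=> v_cyclic [_ brE]; have gB := @rep_gen_bilin K A M.
have mB := @amul_bilin K (repalg A M).
have tB := @tensor_pure_bilin K M M.
pose f (α β1 β2 β3 : M) := v (α ⊗ β2) *:
  tlift (fun x y => rep_gen x β1 ** rep_gen y β3) (D (a ⊗ b)).
have fT α' : trilin (f α').
  rewrite /f /tlift; split=> [w|x w c z z'].
    split=> [y c x x'|x c y y'].
      rewrite scalerA mulrC -scalerA -scalerDr; congr (_ *: _).
      rewrite scaler_sumr -big_split; apply: eq_bigr => p _ /=.
      by rewrite (bilinDr gB) (bilinZr gB) (bilinDl mB) (bilinZl mB).
    by rewrite (bilinDr tB) (bilinZr tB) linearP scalerDl scalerA.
  rewrite scalerA mulrC -scalerA -scalerDr; congr (_ *: _).
  rewrite scaler_sumr -big_split; apply: eq_bigr => p _ /=.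
  by rewrite (bilinDr gB) (bilinZr gB) (bilinDr mB) (bilinZr mB).
rewrite !rep_act_gen !brE -/(f _) -/(f _) comul3_unit_act // /tlift3.
rewrite /tlift linear_sum; apply: eq_bigr => p _.
rewrite linear_sum; apply: eq_bigr => q _.
rewrite /f cyclic_form_invariant // linearZZ.
congr (_ *: _); rewrite linear_sum; apply: eq_bigr => r _.
by rewrite /= rep_actM !rep_act_gen.
Qed.

Theorem theorem7p3 (K : comPzRingType) (n : int) (A : galgType K)
    (D : {linear tensor A A -> tensor A A}) (D_double : double_bracket n D)
    (M : counitalCoalgType K) (v : {scalar tensor M M})
    (v_cyclic : cyclic_form v) :
  (forall α β : M, v (α ⊗ β) = v (β ⊗ α)) /\
  (forall br : {linear tensor (repalg A M) (repalg A M) -> repalg A M},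
    induced_bracket n D v br ->
    (forall (u : dual_unit M) (x y : repalg A M),
      br (rep_act u x ⊗ rep_act u y) = rep_act u (br (x ⊗ y))) /\
    (forall x y : repalg A M,
      rep_fixed x -> rep_fixed y -> rep_fixed (br (x ⊗ y)))).
Proof.
split=> [α β|br brP]; first exact: cyclic_form_sym.
have equi (u : dual_unit M) (x y : repalg A M) :
    br (rep_act u x ⊗ rep_act u y) = rep_act u (br (x ⊗ y)).
  apply: (biderivation_equivariant brP.1) => a b α β.
  exact: induced_bracket_gen v_cyclic brP.
split=> // x y fx fy u.
by rewrite -equi fx fy.
Qed.
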